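(* Let $X$ be a real Banach space with $\dim X\ge 2$. Then for all $0\le t\le\frac12$, $$t-t^2\le C_Z^I(t)\le t^2-2t+1.$$
   Context: Isosceles orthogonality: $x_1\perp_I x_2$ means $\|x_1+x_2\|=\|x_1-x_2\|$. For $0\le t\le \frac12$, $$C_Z^I(t)=\sup\left\{\frac{\|t x_1+(1-t)x_2\|\cdot\|(1-t)x_1+t x_2\|}{\|x_1+x_2\|^2}: x_1,x_2\in X,\ (x_1,x_2)\neq(0,0),\ x_1\perp_I x_2\right\}.$$ *)

(* Defs.v *)
From HB Require Import structures.
From mathcomp Require Import all_boot all_order all_algebra.
From mathcomp Require Import all_classical all_reals all_analysis.

Set Implicit Arguments.
Unset Strict Implicit.
Unset Printing Implicit Defensive.

Import Order.TTheory GRing.Theory Num.Theory.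
Import numFieldNormedType.Exports.

Local Open Scope classical_set_scope.
Local Open Scope ring_scope.

(* dim X >= 2, for X possibly infinite dimensional. *)
Definition dim_ge2 (R : realType) (X : lmodType R) : Prop :=
  exists x y : X, forall a b : R, a *: x + b *: y = 0 -> a = 0 /\ b = 0.

Definition isosceles_orthogonal (R : realType) (X : normedModType R)
    (x1 x2 : X) : Prop :=
  `|x1 + x2| = `|x1 - x2|.

(* The supremum is taken in the extended reals, so that it is meaningful before
   the set is known to be nonempty and bounded. The denominator never vanishes
   on the admissible pairs: `|x1 + x2| = `|x1 - x2| = 0 forces x1 = x2 = 0. *)
Definition CZI (R : realType) (X : normedModType R) (t : R) : \bar R :=
  ereal_sup
    [set r : \bar R | exists x1 x2 : X,
      [/\ (x1, x2) <> (0, 0),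
          isosceles_orthogonal x1 x2 &
          r = (`|t *: x1 + (1 - t) *: x2| * `|(1 - t) *: x1 + t *: x2|
               / `|x1 + x2| ^+ 2)%:E]].

(* Main.v *)
(* Put u = x1 + x2 and v = x1 - x2, so that |u| = |v| by isosceles orthogonality.
   Both t x1 + (1 - t) x2 and (1 - t) x1 + t x2 have the form u / 2 -+ (1 - 2 t) / 2 v,
   hence norm at most (1 - t) |u|; this is the upper bound. The lower bound is
   attained at the pairs (x, 0) with x <> 0. *)
Require Import Defs.
From HB Require Import structures.
From mathcomp Require Import all_boot all_order all_algebra.
From mathcomp Require Import all_classical all_reals all_analysis.
From mathcomp Require Import ring lra.

Import Order.TTheory GRing.Theory Num.Theory.
Import numFieldNormedType.Exports.

Local Open Scope ring_scope.

Lemma isosceles_orthogonal_sym (R : realType) (X : normedModType R) (x y : X) :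
  isosceles_orthogonal x y -> isosceles_orthogonal y x.
Proof. by rewrite /isosceles_orthogonal distrC addrC. Qed.

(** For [t <= 1 / 2] the coefficients [1 / 2] and [(1 - 2 * t) / 2] are both nonnegative, and they
    add up to [1 - t]. *)
Lemma isosceles_orthogonal_conv_le (R : realType) (X : normedModType R)
    (x y : X) (t : R) :
  t <= 1 / 2 -> isosceles_orthogonal x y ->
  `|t *: x + (1 - t) *: y| <= (1 - t) * `|x + y|.
Proof.
move=> ht xy.
have -> : t *: x + (1 - t) *: y
    = (1 / 2) *: (x + y) - ((1 - 2 * t) / 2) *: (x - y).
  rewrite scalerDr scalerBr opprD opprK addrACA -scalerBl -scalerDl.
  by congr (_ *: _ + _ *: _); field.
apply: le_trans (ler_normB _ _) _.
have h0 : 0 <= 1 / 2 :> R by lra.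
have ht0 : 0 <= (1 - 2 * t) / 2 by lra.
rewrite (normrZ (1 / 2)) (normrZ ((1 - 2 * t) / 2)) -xy.
rewrite (ger0_norm h0) (ger0_norm ht0) -mulrDl ler_wpM2r//.
lra.
Qed.

Theorem proposition2 (R : realType) (X : completeNormedModType R)
    (hdim : dim_ge2 X) (t : R) (ht0 : 0 <= t) (ht1 : t <= 1 / 2) :
  ((t - t ^+ 2)%:E <= CZI X t)%E /\
  (CZI X t <= (t ^+ 2 - 2 * t + 1)%:E)%E.
Proof.
split.
  have [x [y xy]] := hdim.
  have x0 : x != 0.
    (* If [x = 0], the coefficients 1 and 0 give a nontrivial relation. *)
    apply/eqP => x0; have [] := xy 1 0.
      by rewrite x0 scaler0 scale0r addr0.
    by move/eqP; rewrite oner_eq0.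
  apply: ereal_sup_ubound; exists x, 0; split.
  - by move=> [] /eqP; rewrite (negbTE x0).
  - by rewrite /isosceles_orthogonal addr0 subr0.
  - rewrite !scaler0 !addr0 !normrZ !ger0_norm//; last lra.
    have n0 : `|x| != 0 by rewrite normr_eq0.
    by congr (_%:E); field.
apply: ge_ereal_sup => _ [x [y [_ xy ->]]].
rewrite lee_fin.
have -> : t ^+ 2 - 2 * t + 1 = (1 - t) * (1 - t) by ring.
(* At a zero denominator the quotient is 0, since [0^-1 = 0], and the bound is a square. *)
have [xy0|xy0] := eqVneq `|x + y| 0.
  by rewrite xy0 expr0n invr0 mulr0 mulr_ge0//; lra.
rewrite ler_pdivrMr ?exprn_gt0 ?lt_def ?xy0//=.
(* Each factor is compared with its own [(1 - t) * |x + y|]. *)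
rewrite expr2 mulrACA ler_pM//.
  exact: isosceles_orthogonal_conv_le.
(* The second factor is the first with [x] and [y] exchanged. *)
rewrite addrC [x + y]addrC.
exact/isosceles_orthogonal_conv_le/isosceles_orthogonal_sym.
Qed.
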